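(* The Greedy-RP mechanism (the Greedy-RP allocation scheme together with the Greedy-RP pricing scheme) is truthful for single-minded bidders. That is, for any ask $a=(\langle s_1,\dots,s_k\rangle,\langle o_1,\dots,o_k\rangle)$, any relativity vector $\langle f_1,\dots,f_k\rangle$ with $f_i>0$ and $f_1\le\dots\le f_k$, any $q>0$, any user $u_j$ who is single-minded with true bundle $d^*$ and true valuation $v^*\ge 0$, any bids of the other users, and any alternative report $(d,v)$ of $u_j$, the utility of $u_j$ when she bids $(d^*,v^* )$ is at least her utility when she bids $(d,v)$ (the other bids unchanged).
   Context: Setting. A single seller offers $k$ types of virtual machines. The ask $a=(\langle s_1,\dots,s_k\rangle,\langle o_1,\dots,o_k\rangle)$ consists of supplied amounts $s_i$ (nonnegative integers) and reserve prices $o_i\ge 0$ per unit. There are $n$ users $U=\{u_1,\dots,u_n\}$, each submitting one bid $b_j=(d_j,v_j)$, where the bundle $d_j=\langle r_{1j},\dots,r_{kj}\rangle$ is a nonzero vector of nonnegative integers ($r_{ij}$ is the requested amount of type $i$) and $v_j\ge 0$ is the declared valuation. For bundles $d=\langle r_1,\dots,r_k\rangle$ and $d'=\langle r'_1,\dots,r'_k\rangle$, write $d\subseteq d'$ if $r_i\le r'_i$ for all $i$. Fixed parameters (independent of the bids): a relativity vector $\langle f_1,\dots,f_k\rangle$ with $f_i>0$ and $f_1\le f_2\le\dots\le f_k$, and a real $q>0$. Define the bundle reserve price $\hat o(d_j)=\sum_{i=1}^k r_{ij}o_i$, the bundle weight $\hat d(d_j)=\sum_{i=1}^k r_{ij}f_i$,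 the bid density $e(b_j)=v_j/|\hat d(d_j)|^q$, and the bid-specific reserve density $e_{res}(b_j)=\hat o(d_j)/|\hat d(d_j)|^q$. Greedy-RP allocation scheme. Input: the ask and the vector of bids. Start with $W=\emptyset$. Sort the users in non-increasing order of bid density $e(b_j)$, ties being broken by a fixed priority order on the users that does not depend on the bids. Process the users in this order; when $u_j$ is processed, add $u_j$ to $W$ if and only if both (ARC) $r_{ij}+\sum_{j':u_{j'}\in W} r_{ij'}\le s_i$ for all $i=1,\dots,k$ (with the current $W$), and (RPC) $\hat o(d_j)\le v_j$. Output: the set $W$ of winners. Each winner receives exactly her requested bundle; the other users receive nothing. Greedy-RP pricing scheme. Input: the ask $a$, the bids $B$ and the set $W$ of winners output by the allocation scheme on $(a,B)$. For each $u_j\in W$: let $B'$ be $B$ with the bid $b_j$ removed; let $W'$ be the output of the allocation scheme on $(a,B')$ (same $f$, $q$ and tie-breaking order); let $W'_j=W'\setminus W$; set $e_j^{comp}=\max\{e(b_h):u_h\in W'_j\}$ if $W'_j\ne\emptyset$ and $e_j^{comp}=0$ otherwise; set $e_j^{cr}=\max(e_j^{comp},e_{res}(b_j))$ and $p_j=e_j^{cr}\,|\hat d(d_j)|^q$. For each $u_j\notin W$, set $p_j=0$. Single-minded bidders and utility. A single-minded bidder has a true bundle $d^*$ (a nonzero vector of nonnegative integers) and a true valuation $v^*\ge 0$: she values the bundle she receives at $v^*$ if it contains $d^*$ (i.e. $d^*\subseteq$ received bundle), and at $0$ otherwise (including when she receives nothing). Her utility is her true value for the bundle received minus her payment $p_j$.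 A bidder may report any bid $(d,v)$ with $d$ a nonzero bundle and $v\ge 0$, not necessarily equal to $(d^*,v^* )$. A mechanism is truthful if reporting the true type maximizes each bidder's utility regardless of the other users' reported bids. *)

(* Defs.v *)
From HB Require Import structures.
From mathcomp Require Import all_boot all_order all_algebra.
From mathcomp Require Import reals exp.

Set Implicit Arguments.
Unset Strict Implicit.
Unset Printing Implicit Defensive.

Import Order.TTheory GRing.Theory Num.Theory.
Local Open Scope ring_scope.

Definition bundle (k : nat) := {ffun 'I_k -> nat}.

Definition bundle0 {k : nat} : bundle k := [ffun=> 0%N].

Definition subbundle {k : nat} (d d' : bundle k) : bool :=
  [forall i, (d i <= d' i)%N].

Record bid (R : realType) (k : nat) := Bid {
  requested : bundle k;
  valuation : R;
  requested_neq0 : requested != bundle0;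
  valuation_ge0 : 0 <= valuation }.

Record ask (R : realType) (k : nat) := Ask {
  supply : 'I_k -> nat;
  reserve : 'I_k -> R;
  reserve_ge0 : forall i, 0 <= reserve i }.

Definition bid_profile (R : realType) (k n : nat) := 'I_n -> bid R k.

(* What a mechanism decides on a bid profile: who wins, and what each user pays.
   A winner always receives exactly the bundle of her bid. *)
Record outcome (R : realType) (n : nat) := Outcome {
  winners : {set 'I_n};
  payment : 'I_n -> R }.

Definition mechanism (R : realType) (k n : nat) :=
  bid_profile R k n -> outcome R n.

Section GreedyRP.
Context {R : realType} {k n : nat}.
Variables (a : ask R k) (f : 'I_k -> R) (q : R) (prio : rel 'I_n).

Definition bundle_reserve (d : bundle k) : R := \sum_i (d i)%:R * reserve a i.

Definition bundle_weight (d : bundle k) : R := \sum_i (d i)%:R * f i.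

Definition weight_power (d : bundle k) : R := `|bundle_weight d| `^ q.

Definition density (b : bid R k) : R :=
  valuation b / weight_power (requested b).

Definition reserve_density (b : bid R k) : R :=
  bundle_reserve (requested b) / weight_power (requested b).

(* [prio h j] reads: [h] is [j] or has priority over [j]. *)
Definition processed_before (B : bid_profile R k n) : rel 'I_n :=
  fun h j => (density (B j) < density (B h))
          || ((density (B h) == density (B j)) && prio h j).

Definition ARC (B : bid_profile R k n) (W : {set 'I_n}) (j : 'I_n) : bool :=
  [forall i, (requested (B j) i + \sum_(h in W) requested (B h) i
                <= supply a i)%N].

Definition RPC (b : bid R k) : bool :=
  bundle_reserve (requested b) <= valuation b.

Definition greedy_step (B : bid_profile R k n) (W : {set 'I_n}) (j : 'I_n) :
    {set 'I_n} :=
  if ARC B W j && RPC (B j) then j |: W else W.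

(* The scheme is run on the bids of the users in [A] only, so that removing the
   bid of [j] from the profile [B] amounts to taking [A := [set~ j]]. *)
Definition greedy_allocation (B : bid_profile R k n) (A : {set 'I_n}) :
    {set 'I_n} :=
  foldl (greedy_step B) set0 (sort (processed_before B) (enum A)).

(* Densities are nonnegative, so that the default value 0 of the iterated
   maximum only matters when the range is empty. *)
Definition competitor_density (B : bid_profile R k n) (W : {set 'I_n})
    (j : 'I_n) : R :=
  \big[Num.max/0]_(h in greedy_allocation B [set~ j] :\: W) density (B h).

Definition critical_density (B : bid_profile R k n) (W : {set 'I_n})
    (j : 'I_n) : R :=
  Num.max (competitor_density B W j) (reserve_density (B j)).

Definition greedy_payment (B : bid_profile R k n) (W : {set 'I_n})
    (j : 'I_n) : R :=
  if j \in W then critical_density B W j * weight_power (requested (B j))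
  else 0.

Definition greedy_RP : mechanism R k n := fun B =>
  let W := greedy_allocation B [set: 'I_n] in Outcome W (greedy_payment B W).

End GreedyRP.

Section Truthfulness.
Context {R : realType} {k n : nat}.

Definition received (M : mechanism R k n) (B : bid_profile R k n) (j : 'I_n) :
    bundle k :=
  if j \in winners (M B) then requested (B j) else bundle0.

(* A single-minded type is a bid: the truly desired bundle and its true value. *)
Definition single_minded_value (t : bid R k) (d : bundle k) : R :=
  if subbundle (requested t) d then valuation t else 0.

Definition utility (M : mechanism R k n) (t : bid R k) (B : bid_profile R k n)
    (j : 'I_n) : R :=
  single_minded_value t (received M B j) - payment (M B) j.

Definition truthful (M : mechanism R k n) : Prop :=
  forall (B : bid_profile R k n) (j : 'I_n) (t b : bid R k),
    utility M t [eta B with j |-> b] j <= utility M t [eta B with j |-> t] j.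

End Truthfulness.

(* Main.v *)
(* Fix the bids of the other users. Run the greedy scheme on them alone: for a
   bundle [d], let [K d] be the density of the first user whose acceptance leaves
   no room for [d] (0 if there is none). A user bidding on [d] wins iff [d] fits
   the supply, her value reaches the reserve price of [d], and she is processed
   before that first user; the maximum over [W' \ W] in the pricing scheme is
   exactly [K d]. So a winner pays a price that depends on [d] only, is monotone
   in [d], and is a threshold for her declared value. Misreporting the value can
   then not help, and asking for a larger bundle can only raise the price. *)
Require Import Defs.
From HB Require Import structures.
From mathcomp Require Import all_boot all_order all_algebra.
From mathcomp Require Import reals exp.

Set Implicit Arguments.
Unset Strict Implicit.
Unset Printing Implicit Defensive.

Import Order.TTheory GRing.Theory Num.Theory.
Local Open Scope ring_scope.

(** * Bundles, weighted sums and weight powers *)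

Section Bundles.
Context {R : realType} {k : nat}.
Implicit Types (d : bundle k) (w : 'I_k -> R).

Lemma weighted_sum_ge0 w d :
  (forall i, 0 <= w i) -> 0 <= \sum_i (d i)%:R * w i.
Proof. by move=> w_ge0; apply: sumr_ge0 => i _; rewrite mulr_ge0. Qed.

Lemma weighted_sum_le w d d' :
  (forall i, 0 <= w i) -> subbundle d d' ->
  \sum_i (d i)%:R * w i <= \sum_i (d' i)%:R * w i.
Proof.
move=> w_ge0 /forallP sub_dd'; apply: ler_sum => i _.
by rewrite ler_wpM2r // ler_nat.
Qed.

Lemma subbundle0r d : subbundle d bundle0 = (d == bundle0).
Proof.
apply/forallP/eqP => [d_le0|-> //].
by apply/ffunP => i; have := d_le0 i; rewrite !ffunE leqn0 => /eqP.
Qed.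

(** Allows passing between densities and values: with every [f i] positive, only the zero bundle has
    weight 0. *)
Lemma weight_power_gt0 (f : 'I_k -> R) (q : R) d :
  (forall i, 0 < f i) -> d != bundle0 -> 0 < weight_power f q d.
Proof.
move=> f_gt0 d_neq0; apply: powR_gt0; rewrite normr_gt0.
apply: contra d_neq0 => /eqP weight0; apply/eqP/ffunP => i; rewrite ffunE.
have term_ge0 i' : 0 <= (d i')%:R * f i' by rewrite mulr_ge0 // ltW.
have := psumr_eq0P (fun i' _ => term_ge0 i') weight0 => /(_ i isT)/eqP.
by rewrite mulf_eq0 (gt_eqF (f_gt0 i)) orbF pnatr_eq0 => /eqP.
Qed.

Lemma weight_power_le (f : 'I_k -> R) (q : R) d d' :
  (forall i, 0 < f i) -> 0 <= q -> subbundle d d' ->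
  weight_power f q d <= weight_power f q d'.
Proof.
move=> f_gt0 q_ge0 sub_dd'; have f_ge0 i : 0 <= f i by apply: ltW.
apply: ge0_ler_powR; rewrite ?nnegrE ?normr_ge0 //.
by rewrite !ger0_norm ?weighted_sum_ge0 // weighted_sum_le.
Qed.

End Bundles.

(** * Greedy runs and blocking densities *)

Section Greedy.
Context {R : realType} {k n : nat}.
Variables (a : ask R k) (f : 'I_k -> R) (q : R).
Implicit Types (B : bid_profile R k n) (W : {set 'I_n}) (s : seq 'I_n).
Implicit Types (d : bundle k) (h j x : 'I_n).

Definition greedy_run B W s : {set 'I_n} := foldl (greedy_step a B) W s.

(** Extends [ARC] to a bundle that need not be anyone's bid; [ARC a B W x] unfolds to the case
    [d := requested (B x)]. *)
Definition fits B W d : bool :=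
  [forall i, (d i + \sum_(h in W) requested (B h) i <= supply a i)%N].

Definition denser B : rel 'I_n :=
  [rel h x | density f q (B x) <= density f q (B h)].

(* The quantity [K d] for the users in [s] processed from the winners [W]; it has
   this meaning only if [d] fits next to [W]. *)
Fixpoint blocking_density B W s d : R :=
  if s is x :: s' then
    if fits B (greedy_step a B W x) d
    then blocking_density B (greedy_step a B W x) s' d
    else density f q (B x)
  else 0.

Lemma density_ge0 (b : bid R k) : 0 <= density f q b.
Proof. by rewrite divr_ge0 ?valuation_ge0 ?powR_ge0. Qed.

Lemma denser_trans B : transitive (denser B).
Proof. by move=> y x z /= xy yz; apply: le_trans xy. Qed.

Lemma fits_subset B W W' d : W \subset W' -> fits B W' d -> fits B W d.
Proof.
move=> /setIidPr sub_WW' /forallP fitsW'; apply/forallP => i.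
apply: leq_trans (fitsW' i); rewrite leq_add2l.
by rewrite [leqRHS](big_setID W) sub_WW' leq_addr.
Qed.

Lemma fits_subbundle B W d d' : subbundle d d' -> fits B W d' -> fits B W d.
Proof.
move=> /forallP sub_dd' /forallP fitsW; apply/forallP => i.
by apply: leq_trans (fitsW i); rewrite leq_add2r.
Qed.

Lemma greedy_step_subset B W x : W \subset greedy_step a B W x.
Proof. by rewrite /greedy_step; case: ifP => // _; apply: subsetUr. Qed.

Lemma greedy_step_sub1 B W x : greedy_step a B W x \subset x |: W.
Proof. by rewrite /greedy_step; case: ifP => // _; apply: subsetUr. Qed.

Lemma greedy_run_subset B W s : W \subset greedy_run B W s.
Proof.
elim: s W => //= x s IHs W.
exact: subset_trans (greedy_step_subset B W x) (IHs _).
Qed.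

Lemma mem_greedy_run B W s h :
  h \in greedy_run B W s -> (h \in W) || (h \in s).
Proof.
elim: s W => [|x s IHs] W /=; first by move=> ->.
case/IHs/orP => [/(subsetP (greedy_step_sub1 B W x))|hs].
  by rewrite in_setU1 inE orbCA orbA => ->.
by rewrite inE hs !orbT.
Qed.

(** * Independence from the bid of [j] *)

Lemma greedy_step_eq_off B B' W j x :
  (forall h, h != j -> B h = B' h) -> x != j -> j \notin W ->
  greedy_step a B W x = greedy_step a B' W x.
Proof.
move=> eqBB' x_neq_j jW; rewrite /greedy_step eqBB' //.
suff -> : ARC a B W x = ARC a B' W x by [].
apply: eq_forallb => i; rewrite eqBB' //.
rewrite (eq_bigr (fun h => requested (B' h) i)) // => h hW.
by rewrite eqBB' //; apply: contraNneq jW => <-.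
Qed.

Lemma fits_eq_off B B' W j d :
  (forall h, h != j -> B h = B' h) -> j \notin W ->
  fits B W d = fits B' W d.
Proof.
move=> eqBB' jW; apply: eq_forallb => i.
rewrite (eq_bigr (fun h => requested (B' h) i)) // => h hW.
by rewrite eqBB' //; apply: contraNneq jW => <-.
Qed.

Lemma notin_greedy_step B W x j :
  x != j -> j \notin W -> j \notin greedy_step a B W x.
Proof.
move=> x_neq_j jW; apply: contra (subsetP (greedy_step_sub1 B W x) j) _.
by rewrite in_setU1 eq_sym (negPf x_neq_j).
Qed.

(** A run that never meets [j] reads only bids on which the two profiles agree. *)
Lemma blocking_density_eq_off B B' W s j d :
  (forall h, h != j -> B h = B' h) -> j \notin s -> j \notin W ->
  blocking_density B W s d = blocking_density B' W s d.
Proof.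
move=> eqBB'; elim: s W => //= x s IHs W; rewrite inE negb_or eq_sym.
case/andP=> x_neq_j js jW; have stepj := notin_greedy_step B x_neq_j jW.
rewrite IHs // (fits_eq_off _ eqBB' stepj) -eqBB' //.
by rewrite (greedy_step_eq_off eqBB' x_neq_j jW).
Qed.

(** * Bounds and monotonicity of the blocking density *)

Lemma blocking_density_ge0 B W s d : 0 <= blocking_density B W s d.
Proof. by elim: s W => //= x s IHs W; case: ifP => _ //; apply: density_ge0. Qed.

Lemma blocking_density_ub B W s d (e : R) :
  0 <= e -> (forall h, h \in s -> density f q (B h) <= e) ->
  blocking_density B W s d <= e.
Proof.
move=> e_ge0; elim: s W => //= x s IHs W ub_e; case: ifP => _.
  by apply: IHs => h hs; apply: ub_e; rewrite inE hs orbT.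
by apply: ub_e; rewrite inE eqxx.
Qed.

(** The larger bundle is blocked no later, and densities do not increase along the list. *)
Lemma blocking_density_le B W s d d' :
  sorted (denser B) s -> subbundle d d' ->
  blocking_density B W s d <= blocking_density B W s d'.
Proof.
move=> + sub_dd'; elim: s W => //= x s IHs W path_s.
have [fits_d'|_] := boolP (fits B _ d').
  by rewrite (fits_subbundle sub_dd' fits_d') IHs // (path_sorted path_s).
case: ifP => // _; apply: blocking_density_ub; first exact: density_ge0.
by move=> h; apply: (allP (order_path_min (@denser_trans B) path_s)).
Qed.

(** Winners only accumulate, so a bundle that fits after [s1] fits at every earlier stage: nobody in
    [s1] blocks it. *)
Lemma blocking_density_cat_fits B W s1 s2 d :
  fits B (greedy_run B W s1) d ->
  blocking_density B W (s1 ++ s2) d = blocking_density B (greedy_run B W s1) s2 d.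
Proof.
elim: s1 W => //= x s1 IHs W fits_s1.
by rewrite (fits_subset (greedy_run_subset _ _ s1) fits_s1) IHs.
Qed.

(** The blocking user lies in [s1], where [e] bounds all densities from below. *)
Lemma blocking_density_cat_blocked B W s1 s2 d (e : R) :
  (forall h, h \in s1 -> e <= density f q (B h)) ->
  fits B W d -> ~~ fits B (greedy_run B W s1) d ->
  e <= blocking_density B W (s1 ++ s2) d.
Proof.
elim: s1 W => [|x s1 IHs] W lb_e; first by rewrite /= => ->.
move=> _ /= Nfits; case: ifPn => [fits_x|_].
  by apply: IHs => // h hs; apply: lb_e; rewrite inE hs orbT.
by apply: lb_e; rewrite inE eqxx.
Qed.

(** * Runs with and without user [j] *)

Lemma ARC_subset B W W' x : W \subset W' -> ARC a B W' x -> ARC a B W x.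
Proof. exact: fits_subset. Qed.

(** Both sides say that the bundles of [x], [j] and [W] together respect the supply. *)
Lemma ARC_setU1 B W j x :
  x \notin W -> j \notin W -> ARC a B (j |: W) x = fits B (x |: W) (requested (B j)).
Proof.
by move=> xW jW; apply: eq_forallb => i; rewrite !big_setU1 //= addnCA.
Qed.

(* As long as the bundle of [j] still fits next to the set [W] reached without
   [j], both runs accept the same users. The first user accepted without [j] that
   leaves no room for [j] is rejected with [j]; users processed later can only
   have smaller densities. *)
Lemma bigmax_greedy_run_setD B W s j :
  uniq (j :: s) -> sorted (denser B) s ->
  [disjoint W & s] -> j \notin W -> fits B W (requested (B j)) ->
  \big[Num.max/0]_(h in greedy_run B W s :\: greedy_run B (j |: W) s)
     density f q (B h)
  = blocking_density B W s (requested (B j)).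
Proof.
elim: s W => [|x s IHs] W /=.
  move=> _ _ _ _ _; apply: big_pred0 => h.
  by rewrite !inE; case: (h \in W); rewrite ?orbT ?andbF.
rewrite inE negb_or -andbA => /and4P[j_neq_x js xs us] path_s.
rewrite disjoint_sym disjoint_cons disjoint_sym => /andP[xW disjWs] jW fits_j.
have sW h : h \in s -> h \notin W.
  by move=> hs; rewrite (disjointFl disjWs).
have stepj : j \notin greedy_step a B W x.
  by apply: notin_greedy_step; rewrite // eq_sym.
case: ifPn => [fits_x|Nfits_x].
  (* If [x] is accepted without [j], the room left for [j] is, by [ARC_setU1], room for [x] next to
     [j]; conversely, fewer winners leave more room for [x]. *)
  have -> : greedy_step a B (j |: W) x = j |: greedy_step a B W x.
    move: fits_x; rewrite /greedy_step ARC_setU1 //.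
    case: ifP => [/andP[_ ->] ->|]; first by rewrite setUCA.
    case: ifP => // /andP[fits_xj RPC_x]; rewrite RPC_x andbT.
    rewrite -(ARC_setU1 B xW jW) in fits_xj.
    by rewrite (ARC_subset (subsetUr _ _) fits_xj).
  apply: IHs => //; [by rewrite /= js|exact: path_sorted path_s|].
  rewrite disjoint_subset; apply/subsetP => h.
  move=> /(subsetP (greedy_step_sub1 _ _ _)); rewrite !inE => /orP[/eqP-> //|hW].
  by apply: contraL hW => /sW.
(* As [j] had room next to [W], losing it means that [x] was accepted. *)
have acc_x : greedy_step a B W x = x |: W.
  by move: Nfits_x; rewrite /greedy_step; case: ifP => //; rewrite fits_j.
have rej_x : greedy_step a B (j |: W) x = j |: W.
  by rewrite /greedy_step ARC_setU1 // -acc_x (negPf Nfits_x).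
rewrite acc_x rej_x; apply/eqP; rewrite eq_le; apply/andP; split.
  apply: bigmax_le => [|h]; first exact: density_ge0.
  rewrite inE => /andP[hD /mem_greedy_run]; rewrite in_setU1 -orbA.
  case/or3P => [/eqP-> //|hW|]; last first.
    exact: (allP (order_path_min (@denser_trans B) path_s)).
  case/negP: hD; apply: (subsetP (greedy_run_subset _ _ _)).
  by rewrite in_setU1 hW orbT.
apply: (le_bigmax_cond 0 (fun h => density f q (B h))).
rewrite inE; apply/andP; split; last first.
  by apply: (subsetP (greedy_run_subset _ _ _)); rewrite setU11.
apply/negP => /mem_greedy_run; rewrite in_setU1 (negPf xs) eq_sym.
by rewrite (negPf j_neq_x) (negPf xW).
Qed.

(** * Processing order and the rivals of a user *)

Variables (prio : rel 'I_n) (prio_total : total prio).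
Variables (prio_trans : transitive prio) (prio_antisym : antisymmetric prio).

Local Notation before := (processed_before f q prio).

Definition rivals B j : seq 'I_n := sort (before B) (enum [set~ j]).

Definition rival_density B j d : R := blocking_density B set0 (rivals B j) d.

Lemma processed_before_total B : total (before B).
Proof. by move=> x y; rewrite /processed_before; case: ltgtP => /=. Qed.

Lemma processed_before_trans B : transitive (before B).
Proof.
move=> y x z /orP[lt_yx|/andP[/eqP eq_xy p_xy]];
  move=> /orP[lt_zy|/andP[/eqP eq_yz p_yz]].
- by rewrite /processed_before (lt_trans lt_zy lt_yx).
- by rewrite /processed_before -eq_yz lt_yx.
- by rewrite /processed_before eq_xy lt_zy.
- by rewrite /processed_before eq_xy eq_yz eqxx (prio_trans p_xy p_yz) orbT.
Qed.

Lemma processed_before_antisym B : antisymmetric (before B).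
Proof.
move=> x y; rewrite /processed_before; case: ltgtP => //= _.
exact: prio_antisym.
Qed.

Lemma processed_before_denser B : subrel (before B) (denser B).
Proof. by move=> x y /orP[/ltW //|/andP[/eqP eq_xy _]]; rewrite /denser /= eq_xy. Qed.

Lemma sorted_before_denser B s : sorted (before B) s -> sorted (denser B) s.
Proof. by apply: sub_sorted; apply: processed_before_denser. Qed.

Lemma rivals_sorted B j : sorted (before B) (rivals B j).
Proof. exact: sort_sorted (processed_before_total B) _. Qed.

Lemma mem_rivals B j h : (h \in rivals B j) = (h != j).
Proof. by rewrite mem_sort mem_enum !inE. Qed.

(** Away from [j] the two orders coincide, and a transitive antisymmetric relation admits at most
    one sorted arrangement of a list. *)
Lemma rivals_eq_off B B' j :
  (forall h, h != j -> B h = B' h) -> rivals B j = rivals B' j.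
Proof.
move=> eqBB'.
apply: (@sorted_eq_in _ (before B)).
- by move=> y x z _ _ _; apply: processed_before_trans.
- by move=> x y _ _; apply: processed_before_antisym.
- exact: rivals_sorted.
- rewrite (@eq_in_sorted _ (predC1 j) _ (before B')) ?rivals_sorted //.
    by move=> x y /= xj yj; rewrite /processed_before !eqBB'.
  by apply/allP => x; rewrite mem_rivals.
- by rewrite /rivals perm_sort perm_sym perm_sort.
Qed.

Lemma rival_density_eq_off B B' j d :
  (forall h, h != j -> B h = B' h) -> rival_density B j d = rival_density B' j d.
Proof.
move=> eqBB'; rewrite /rival_density (rivals_eq_off eqBB').
by apply: blocking_density_eq_off eqBB' _ _; rewrite ?mem_rivals ?eqxx ?inE.
Qed.

Lemma rival_density_ge0 B j d : 0 <= rival_density B j d.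
Proof. exact: blocking_density_ge0. Qed.

Lemma rival_density_le B j d d' :
  subbundle d d' -> rival_density B j d <= rival_density B j d'.
Proof. exact/blocking_density_le/sorted_before_denser/rivals_sorted. Qed.

(** * Winning and losing against the rival density *)

Local Notation allocation B := (greedy_allocation a f q prio B [set: 'I_n]).

Lemma split_at_user B j : exists s1 s2,
  [/\ sort (before B) (enum [set: 'I_n]) = s1 ++ j :: s2,
      rivals B j = s1 ++ s2,
      forall h, h \in s1 -> density f q (B j) <= density f q (B h)
    & forall h, h \in s2 -> density f q (B h) <= density f q (B j)].
Proof.
have := sort_sorted (processed_before_total B) (enum [set: 'I_n]).
have := sort_uniq (before B) (enum [set: 'I_n]); rewrite enum_uniq.
(* Sorting by a total transitive relation commutes with filtering, so deleting [j] from the full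
   list leaves her rivals in order. *)
have -> : rivals B j = filter (predC1 j) (sort (before B) (enum [set: 'I_n])).
  rewrite (filter_sort (processed_before_total B) (@processed_before_trans B)).
  rewrite /rivals; congr sort; rewrite {1}/enum_mem /(enum setT) /enum_mem -filter_predI.
  by apply: eq_filter => h; rewrite /= !inE andbT.
have : j \in sort (before B) (enum [set: 'I_n]) by rewrite mem_sort mem_enum inE.
case/splitPr => s1 s2; rewrite cat_uniq /= negb_or.
move=> /and3P[_ /andP[js1 _] /andP[js2 _]].
move=> /sorted_before_denser; rewrite sorted_pairwise; last exact: denser_trans.
rewrite pairwise_cat /= allrel_consr.
move=> /and3P[/andP[/allP lb _] _ /andP[/allP ub _]].
have filter_id s : j \notin s -> filter (predC1 j) s = s.
  by move=> js; apply/all_filterP/allP => h hs /=; apply: contraNneq js => <-.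
by exists s1, s2; split => //; rewrite filter_cat /= eqxx !filter_id.
Qed.

(** Since [j] is in neither [s1] nor [s2], her fate is settled at her own turn, after the run on
    [s1]. *)
Lemma allocation_split B j s1 s2 :
  sort (before B) (enum [set: 'I_n]) = s1 ++ j :: s2 -> rivals B j = s1 ++ s2 ->
  (j \in allocation B)
  = fits B (greedy_run B set0 s1) (requested (B j)) && RPC a (B j).
Proof.
move=> eq_s eq_r; rewrite /greedy_allocation eq_s foldl_cat /= -/(greedy_run _ _ _).
have js h : h \in s1 ++ s2 -> h != j by rewrite -eq_r mem_rivals.
have js1 : j \notin greedy_run B set0 s1.
  apply/negP => /mem_greedy_run; rewrite inE /= => js1.
  by have := js j; rewrite mem_cat js1 eqxx => /(_ isT).
rewrite /greedy_step.
case: ifP => [_|_].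
  by rewrite (subsetP (greedy_run_subset _ _ _)) // setU11.
apply/negP => /mem_greedy_run; rewrite (negPf js1) /= => js2.
by have := js j; rewrite mem_cat js2 orbT eqxx => /(_ isT).
Qed.

Lemma winner_fits B j : j \in allocation B -> fits B set0 (requested (B j)).
Proof.
have [s1 [s2 [eq_s eq_r _ _]]] := split_at_user B j.
rewrite (allocation_split eq_s eq_r) => /andP[+ _].
exact/fits_subset/sub0set.
Qed.

Lemma winner_RPC B j : j \in allocation B -> RPC a (B j).
Proof.
have [s1 [s2 [eq_s eq_r _ _]]] := split_at_user B j.
by rewrite (allocation_split eq_s eq_r) => /andP[].
Qed.

(** The bundle of a winner still fits after [s1], so a blocking user, if any, comes after her. *)
Lemma winner_rival_density B j :
  j \in allocation B -> rival_density B j (requested (B j)) <= density f q (B j).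
Proof.
have [s1 [s2 [eq_s eq_r _ ub]]] := split_at_user B j.
rewrite (allocation_split eq_s eq_r) => /andP[fits_j _].
rewrite /rival_density eq_r blocking_density_cat_fits //.
by apply: blocking_density_ub => //; apply: density_ge0.
Qed.

(** With the reserve price met, the loss is due to a blocking user ahead of [j]. Equality is
    harmless: at the threshold a truthful winner gains nothing. *)
Lemma loser_rival_density B j :
  fits B set0 (requested (B j)) -> RPC a (B j) -> j \notin allocation B ->
  density f q (B j) <= rival_density B j (requested (B j)).
Proof.
have [s1 [s2 [eq_s eq_r lb _]]] := split_at_user B j.
rewrite (allocation_split eq_s eq_r) => fits0 ->; rewrite andbT => Nfits.
by rewrite /rival_density eq_r; apply: blocking_density_cat_blocked.
Qed.

(** Both runs agree on [s1]; from there they differ by [j] only, which is the setting of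
    [bigmax_greedy_run_setD]. *)
Lemma competitor_density_winner B j :
  j \in allocation B ->
  competitor_density a f q prio B (allocation B) j
  = rival_density B j (requested (B j)).
Proof.
have [s1 [s2 [eq_s eq_r _ _]]] := split_at_user B j.
have r_uniq : uniq (j :: rivals B j).
  by rewrite /= mem_rivals eqxx sort_uniq enum_uniq.
have r_sorted := sorted_before_denser (rivals_sorted B j).
rewrite (allocation_split eq_s eq_r) => /andP[fits_j RPC_j].
have alloc : allocation B = greedy_run B (j |: greedy_run B set0 s1) s2.
  rewrite /greedy_allocation eq_s foldl_cat /= /greedy_step.
  by move: fits_j; rewrite /ARC /fits RPC_j => ->.
have rival_alloc : greedy_allocation a f q prio B [set~ j]
    = greedy_run B (greedy_run B set0 s1) s2.
  by rewrite /greedy_allocation -/(rivals B j) eq_r foldl_cat.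
rewrite /competitor_density alloc rival_alloc.
rewrite /rival_density eq_r in r_uniq r_sorted *.
rewrite blocking_density_cat_fits //.
move: r_uniq; rewrite /= mem_cat negb_or cat_uniq.
move=> /andP[/andP[js1 js2] /and3P[_ dis us2]].
apply: bigmax_greedy_run_setD => //.
- by rewrite /= js2.
- by move: r_sorted; rewrite !sorted_pairwise ?pairwise_cat; [case/and3P|exact: denser_trans..].
- rewrite disjoint_sym disjoint_has; apply: contra dis => /hasP[h hs2 /mem_greedy_run].
  by rewrite inE => hs1; apply/hasP; exists h.
- by apply/negP => /mem_greedy_run; rewrite inE (negPf js1).
Qed.

(** * Critical prices *)

Definition critical_price B j d : R :=
  Num.max (rival_density B j d * weight_power f q d) (bundle_reserve a d).

Lemma bundle_reserve_ge0 d : 0 <= bundle_reserve a d.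
Proof. exact/weighted_sum_ge0/reserve_ge0. Qed.

Lemma critical_price_ge0 B j d : 0 <= critical_price B j d.
Proof. by rewrite le_max bundle_reserve_ge0 orbT. Qed.

Lemma critical_price_eq_off B B' j d :
  (forall h, h != j -> B h = B' h) -> critical_price B j d = critical_price B' j d.
Proof. by move=> eqBB'; rewrite /critical_price (rival_density_eq_off _ eqBB'). Qed.

Hypotheses (f_gt0 : forall i, 0 < f i) (q_ge0 : 0 <= q).

Lemma critical_price_le B j d d' :
  subbundle d d' -> critical_price B j d <= critical_price B j d'.
Proof.
move=> sub_dd'; rewrite ge_max !le_max; apply/andP; split; apply/orP; [left|right].
  by rewrite ler_pM ?rival_density_ge0 ?powR_ge0 ?rival_density_le ?weight_power_le.
exact/weighted_sum_le/sub_dd'/reserve_ge0.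
Qed.

Lemma payment_winner B j :
  j \in allocation B ->
  payment (greedy_RP a f q prio B) j = critical_price B j (requested (B j)).
Proof.
move=> win_j; rewrite /= /greedy_payment win_j /critical_density.
rewrite competitor_density_winner // maxr_pMl ?powR_ge0 //.
by rewrite divfK // gt_eqF // weight_power_gt0 // requested_neq0.
Qed.

Lemma winner_critical_price B j :
  j \in allocation B -> critical_price B j (requested (B j)) <= valuation (B j).
Proof.
move=> win_j; rewrite ge_max -ler_pdivlMr ?weight_power_gt0 ?requested_neq0 //.
by rewrite winner_rival_density //; apply: winner_RPC.
Qed.

(** A bundle within the supply loses only to rivals or to the reserve price, and either bounds the
    value. A bundle exceeding the supply loses at any value, hence the first hypothesis. *)
Lemma loser_critical_price B j :
  fits B set0 (requested (B j)) -> j \notin allocation B ->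
  valuation (B j) <= critical_price B j (requested (B j)).
Proof.
move=> fits0 lose_j; rewrite le_max -ler_pdivrMr ?weight_power_gt0 ?requested_neq0 //.
have [RPC_j|] := boolP (RPC a (B j)); first by rewrite loser_rival_density.
by rewrite /RPC -ltNge => /ltW->; rewrite orbT.
Qed.

(** * Utilities of winners and losers *)

Local Notation utility := (utility (greedy_RP a f q prio)).

Lemma utility_winner B (t : bid R k) j :
  j \in allocation B ->
  utility t B j = single_minded_value t (requested (B j))
                  - critical_price B j (requested (B j)).
Proof. by move=> win_j; rewrite /Defs.utility payment_winner // /received win_j. Qed.

(** The true bundle is nonzero, so receiving nothing is worth 0. *)
Lemma utility_loser B (t : bid R k) j : j \notin allocation B -> utility t B j = 0.
Proof.
move=> /negPf lose_j; rewrite /Defs.utility /received /= /greedy_payment lose_j.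
by rewrite /single_minded_value subbundle0r (negPf (requested_neq0 t)) subr0.
Qed.

Lemma truthful_utility_ge0 B j : 0 <= utility (B j) B j.
Proof.
have [win_j|lose_j] := boolP (j \in allocation B); last by rewrite utility_loser.
rewrite utility_winner // /single_minded_value /subbundle.
by rewrite (introT forallP) ?subr_ge0 ?winner_critical_price.
Qed.

End Greedy.

(** * Comparison of the truthful report with an arbitrary one *)

Theorem theorem1 (R : realType) (k n : nat) (a : ask R k)
    (f : 'I_k -> R) (q : R) (prio : rel 'I_n)
    (f_gt0 : forall i, 0 < f i)
    (f_nondecreasing : forall i i' : 'I_k, (i <= i')%N -> f i <= f i')
    (q_gt0 : 0 < q)
    (prio_total : total prio)
    (prio_trans : transitive prio)
    (prio_antisym : antisymmetric prio) :
  truthful (greedy_RP a f q prio).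
Proof.
move=> B j t b; set Bt := [eta B with j |-> t]; set Bb := [eta B with j |-> b].
have Btj : Bt j = t by rewrite /= eqxx.
have Bbj : Bb j = b by rewrite /= eqxx.
have eq_off h : h != j -> Bb h = Bt h by move=> /negPf hj; rewrite /= hj.
have q_ge0 := ltW q_gt0.
have utility_t_ge0 : 0 <= utility (greedy_RP a f q prio) t Bt j.
  by rewrite -[t in utility _ t]Btj; apply: truthful_utility_ge0.
have [win_b|lose_b] :=
  boolP (j \in greedy_allocation a f q prio Bb [set: 'I_n]); last first.
  by rewrite utility_loser.
(* The price does not depend on the bid of [j], so it may be computed in [Bt]. *)
rewrite utility_winner // Bbj (critical_price_eq_off _ _ _ _ _ _ _ eq_off) //.
rewrite /single_minded_value; case: ifPn => [sub_tb|_]; last first.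
  (* A bundle that misses the true one is worth 0 and its price is nonnegative. *)
  apply: le_trans utility_t_ge0.
  by rewrite sub0r oppr_le0 critical_price_ge0.
have price_le : critical_price a f q prio Bt j (requested t)
    <= critical_price a f q prio Bt j (requested b).
  exact: critical_price_le.
have [win_t|lose_t] :=
  boolP (j \in greedy_allocation a f q prio Bt [set: 'I_n]).
  rewrite utility_winner // /single_minded_value Btj /subbundle.
  by rewrite (introT forallP) // lerB.
(* Here [b] wins with a bundle containing the true one, so the true bundle is within the supply too.
   Losing with [t] then bounds the true value by the price for [t], hence by the price for [b]. *)
rewrite utility_loser // subr_le0; apply: le_trans price_le.
rewrite -Btj loser_critical_price // Btj.
apply: fits_subbundle sub_tb _; rewrite -(fits_eq_off _ _ eq_off) ?inE // -Bbj.
exact: winner_fits win_b.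
Qed.
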